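(* Let $\Gamma=\langle a,t\rangle$ and let $K=\langle x,y\rangle$ be the subgroup of $\Gamma$ generated by $x=at$ and $y=ta$. Then $K$ is torsion-free; thus $\Gamma$ is virtually torsion-free.
   Context: Let $\mathcal T_3=\{0,1,2\}^*$ be the ternary rooted tree; automorphisms act on the left on finite words. For a letter $x$ let $\overline x=x+1\bmod 3$. The automorphism $a$ is given by $a(x\sigma)=\overline x\sigma$. The automorphism $t$ is defined recursively (fixing all first-level vertices) by $t(0x\sigma)=0\overline x\sigma$, $t(1x\sigma)=1x\sigma$, $t(2\sigma)=2t(\sigma)$. $\Gamma$ is the subgroup of $\operatorname{Aut}(\mathcal T_3)$ generated by $a$ and $t$. A group is virtually torsion-free if it has a torsion-free subgroup of finite index. *)

(* Defs.v *)
From HB Require Import structures.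
From mathcomp Require Import all_boot.
From mathcomp Require Import boolp classical_sets functions cardinality.

Set Implicit Arguments.
Unset Strict Implicit.
Unset Printing Implicit Defensive.

Local Open Scope classical_set_scope.

Section Subgroups.
Variable G : groupType.
Implicit Types A H L : set G.

Definition is_subgroup H : Prop := group_closed [in H].

Definition subgroup_gen A : set G := smallest is_subgroup A.

Definition lcosets_of L H : set (set G) :=
  [set [set (g * h)%g | h in H] | g in L].

Definition torsion_free H : Prop :=
  forall g, H g -> forall n : nat, 0 < n -> (g ^+ n = 1)%g -> g = 1%g.

Definition virtually_torsion_free L : Prop :=
  exists H, [/\ is_subgroup H, H `<=` L, finite_set (lcosets_of L H)
              & torsion_free H].

End Subgroups.

Definition word3 : Type := seq 'I_3.

Definition adjacent (u v : word3) : bool :=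
  [exists x : 'I_3, (v == rcons u x) || (u == rcons v x)].

Definition is_tree_aut (f : word3 -> word3) : Prop :=
  [/\ bijective f, f [::] = [::]
    & forall u v, adjacent (f u) (f v) = adjacent u v].

Record tree_aut : Type := TreeAut {
  tree_aut_fun :> word3 -> word3;
  _ : `[< is_tree_aut tree_aut_fun >]
}.

HB.instance Definition _ := [isSub for tree_aut_fun].
HB.instance Definition _ := [Choice of tree_aut by <:].

Lemma tree_autP (f : tree_aut) : is_tree_aut f.
Proof. by apply/asboolP; case: f. Qed.

Lemma tree_aut_eq (f g : tree_aut) : f =1 g -> f = g.
Proof. by move=> fg; apply: val_inj; apply: funext. Qed.

Definition mk_tree_aut (f : word3 -> word3) (fP : is_tree_aut f) : tree_aut :=
  TreeAut (asboolT fP).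

Lemma tree_aut_id : is_tree_aut id.
Proof. by split=> //; exists id. Qed.

Lemma tree_aut_comp (f g : tree_aut) : is_tree_aut (f \o g).
Proof.
have [bf f0 fA] := tree_autP f; have [bg g0 gA] := tree_autP g.
split; first exact: bij_comp.
- by rewrite /= g0.
- by move=> u v; rewrite /= fA gA.
Qed.

Lemma tree_aut_inv_ex (f : tree_aut) :
  {g : word3 -> word3 | cancel f g /\ cancel g f}.
Proof. by apply: cid; have [[g fK gK] _ _] := tree_autP f; exists g. Qed.

Definition tree_aut_inv_fun (f : tree_aut) := sval (tree_aut_inv_ex f).

Lemma tree_aut_inv_funK (f : tree_aut) :
  cancel f (tree_aut_inv_fun f) /\ cancel (tree_aut_inv_fun f) f.
Proof. exact: svalP (tree_aut_inv_ex f). Qed.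

Lemma tree_aut_inv_subproof (f : tree_aut) : is_tree_aut (tree_aut_inv_fun f).
Proof.
have [_ f0 fA] := tree_autP f; have [fK gK] := tree_aut_inv_funK f.
split; first by exists f.
- by rewrite -[in LHS]f0 fK.
- by move=> u v; rewrite -fA !gK.
Qed.

(* (f * g) w = f (g w): automorphisms act on the left, unlike the permutations
   {perm T}, whose product is composition in the opposite order. *)
Definition tree_aut_one : tree_aut := mk_tree_aut tree_aut_id.
Definition tree_aut_mul (f g : tree_aut) : tree_aut :=
  mk_tree_aut (tree_aut_comp f g).
Definition tree_aut_inv (f : tree_aut) : tree_aut :=
  mk_tree_aut (tree_aut_inv_subproof f).

Lemma tree_aut_mulA : associative tree_aut_mul.
Proof. by move=> f g h; apply: tree_aut_eq. Qed.
Lemma tree_aut_mul1 : left_id tree_aut_one tree_aut_mul.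
Proof. by move=> f; apply: tree_aut_eq. Qed.
Lemma tree_aut_mulr1 : right_id tree_aut_one tree_aut_mul.
Proof. by move=> f; apply: tree_aut_eq. Qed.
Lemma tree_aut_mulV : left_inverse tree_aut_one tree_aut_inv tree_aut_mul.
Proof. by move=> f; apply: tree_aut_eq => w; apply: (tree_aut_inv_funK f).1. Qed.
Lemma tree_aut_mulrV : right_inverse tree_aut_one tree_aut_inv tree_aut_mul.
Proof. by move=> f; apply: tree_aut_eq => w; apply: (tree_aut_inv_funK f).2. Qed.

HB.instance Definition _ := isGroup.Build tree_aut
  tree_aut_mulA tree_aut_mul1 tree_aut_mulr1 tree_aut_mulV tree_aut_mulrV.

(* ordS x is x + 1 modulo 3. *)
Definition a_fun (w : word3) : word3 :=
  if w is x :: s then ordS x :: s else [::].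

(* a_fun s covers both t(0 x s') = 0 (x + 1) s' and the one-letter word 0,
   which t fixes. *)
Fixpoint t_fun (w : word3) : word3 :=
  if w is x :: s then
    match val x with
    | 0 => x :: a_fun s
    | 1 => x :: s
    | _ => x :: t_fun s
    end
  else [::].

Lemma tree_aut_order3 (f : word3 -> word3) :
    (forall w, f (f (f w)) = w) -> f [::] = [::] ->
    (forall u x, exists y, f (rcons u x) = rcons (f u) y) ->
  is_tree_aut f.
Proof.
move=> f3 f0 fr.
have adjf u v : adjacent u v -> adjacent (f u) (f v).
  case/existsP=> x /orP[] /eqP->; apply/existsP.
    by have [y ->] := fr u x; exists y; rewrite eqxx.
  by have [y ->] := fr v x; exists y; rewrite eqxx orbT.
split=> //; first by exists (f \o f) => w /=; apply: f3.
move=> u v; apply/idP/idP; last exact: adjf.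
by move=> /adjf /adjf; rewrite !f3.
Qed.

Lemma ordS3 (x : 'I_3) : ordS (ordS (ordS x)) = x.
Proof. by apply: val_inj; case: x => [[|[|[|]]]]. Qed.

Lemma a_fun3 w : a_fun (a_fun (a_fun w)) = w.
Proof. by case: w => //= x s; rewrite ordS3. Qed.

Lemma a_fun_rcons u x : exists y, a_fun (rcons u x) = rcons (a_fun u) y.
Proof. by case: u => [|z s]; [exists (ordS x)|exists x]. Qed.

Lemma t_fun3 w : t_fun (t_fun (t_fun w)) = w.
Proof.
by elim: w => //= -[[|[|[|n]]] lt_n3] s IHs //=; rewrite ?a_fun3 ?IHs.
Qed.

Lemma t_fun_rcons u x : exists y, t_fun (rcons u x) = rcons (t_fun u) y.
Proof.
elim: u => [|[[|[|[|n]]] lt_n3] s [y IHs]] //=.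
- by exists x; case: x => [[|[|[|n]]] lt_n3].
- by have [z ->] := a_fun_rcons s x; exists z.
- by exists x.
- by exists y; rewrite IHs.
Qed.

Definition a : tree_aut :=
  mk_tree_aut (tree_aut_order3 a_fun3 erefl a_fun_rcons).
Definition t : tree_aut :=
  mk_tree_aut (tree_aut_order3 t_fun3 erefl t_fun_rcons).

Definition Gamma : set tree_aut := subgroup_gen [set a; t].

Definition K : set tree_aut := subgroup_gen [set (a * t)%g; (t * a)%g].

(* Main.v *)
Require Import Defs.
From mathcomp Require Import all_boot.
From mathcomp Require Import boolp classical_sets functions cardinality.
From mathcomp Require Import ssralg zmodp.

(** The product [f] of a word in [a] and [t] is given a class [(i, j)], the
    numbers modulo 3 of its letters [a] and [t].  It maps [x :: u] to
    [x + i :: s x u], where the sections [s x] are again products of words, and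
    the classes of the three sections have the form [(U x, U (x + 1))] with
    [U 0 + U 1 + U 2 = j] ([sections_of_class]).

    If [i] and [j] are both nonzero then [f] has infinite order
    ([infinite_order]).  Indeed a power [f ^ n] that is trivial acts trivially
    on the first level, so that [3] divides [n]; but each section of [f ^ 3] is
    a product of [s 0], [s 1], [s 2] in some order, hence has class [(j, j)],
    and the argument starts again with [n / 3].

    If [i = j = 0] and [f] has finite order then its sections have finite order
    too, and none of their classes can have two nonzero entries.  So among
    [U 0, U 1, U 2], whose sum is [0], no two cyclically consecutive ones, that
    is no two, are nonzero; hence they all vanish.  All sections thus satisfy
    the assumptions made on [f], which therefore fixes every letter of every
    word: [f = 1] ([torsion_of_class0]).

    The elements of [K] have classes [(i, i)], so [K] is torsion-free.  Finally
    [K] has the three cosets [K], [a K], [a^2 K] in [Gamma], because left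
    multiplication by [t] permutes them: [t = a^-1 (at)], [t a = (ta)] and
    [t a^2 = a (ta)^-1 (at)^-1] ([coset_repr]). *)

Set Implicit Arguments.
Unset Strict Implicit.
Unset Printing Implicit Defensive.

Import GRing.Theory.

(** * Classes of words in [a] and [t] *)

(** A relation rather than a function: the class belongs to a way of writing [f]
    as a product, and [f] may a priori have several of them. *)
Inductive has_class : tree_aut -> 'I_3 -> 'I_3 -> Prop :=
| has_class1 : has_class 1%g 0%R 0%R
| has_class_a f i j : has_class f i j -> has_class (a * f)%g (i + 1)%R j
| has_class_t f i j : has_class f i j -> has_class (t * f)%g i (j + 1)%R.

Lemma has_classM f g i j k l : has_class f i j -> has_class g k l ->
  has_class (f * g)%g (i + k)%R (j + l)%R.
Proof.
move=> cf cg; elim: cf => [|f' i' j' _ IH|f' i' j' _ IH].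
- by rewrite mul1g !add0r.
- by rewrite -mulgA addrAC; apply: has_class_a.
- by rewrite -mulgA [(j' + 1 + l)%R]addrAC; apply: has_class_t.
Qed.

Lemma a3 : (a * (a * a) = 1)%g.
Proof. by apply: tree_aut_eq => w; apply: a_fun3. Qed.

Lemma t3 : (t * (t * t) = 1)%g.
Proof. by apply: tree_aut_eq => w; apply: t_fun3. Qed.

Lemma aV : (a^-1 = a * a)%g.
Proof. by rewrite -[LHS]mulg1 -a3 mulKg. Qed.

Lemma tV : (t^-1 = t * t)%g.
Proof. by rewrite -[LHS]mulg1 -t3 mulKg. Qed.

Lemma class_a : has_class a 1%R 0%R.
Proof. by rewrite -[a]mulg1 -[1%R]add0r; do !constructor. Qed.

Lemma class_t : has_class t 0%R 1%R.
Proof. by rewrite -[t]mulg1 -[1%R]add0r; do !constructor. Qed.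

Lemma has_classV f i j : has_class f i j -> has_class f^-1%g (- i)%R (- j)%R.
Proof.
have e2 : (-1 = 1 + 1 :> 'I_3)%R by apply: val_inj.
elim=> [|f' i' j' _ IH|f' i' j' _ IH]; rewrite ?invgM ?opprD.
- by rewrite invg1 oppr0; constructor.
- have := has_classM IH (has_classM class_a class_a).
  by rewrite aV e2 !addr0.
- have := has_classM IH (has_classM class_t class_t).
  by rewrite tV e2 !addr0.
Qed.

(** * Sections *)

Lemma a_cons x u : a (x :: u) = (x + 1)%R :: u.
Proof. by congr (_ :: _); apply: val_inj; case: x => [[|[|[|]]]]. Qed.

Lemma t_cons x u : t (x :: u) =
  x :: (if x == 0%R then a u else if x == 1%R then u else t u).
Proof. by case: x => [[|[|[|]]]] // lt3; congr (_ :: _). Qed.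

(** A letter [t] that acts when the first letter of the word has become [0] adds
    a letter [a] to the section, and one that acts when it has become [2 = -1]
    adds a letter [t].  Two cyclically consecutive starting letters thus count
    the same occurrences of [t], once as [a] and once as [t]: this is why a
    single function [U] describes the classes of the three sections. *)
Lemma sections_of_class f i j : has_class f i j ->
  exists s : 'I_3 -> tree_aut, exists U : 'I_3 -> 'I_3,
  [/\ forall x u, f (x :: u) = (x + i)%R :: s x u,
      forall x, has_class (s x) (U x) (U (x + 1)%R)
    & (\sum_x U x)%R = j].
Proof.
elim=> [|f' i' j' _ [s [U [fE cs sU]]]|f' i' j' _ [s [U [fE cs sU]]]].
- exists (fun=> 1%g), (fun=> 0%R); split=> [x u|x|]; first by rewrite addr0.
    exact: has_class1.
  by rewrite big1.
- exists s, U; split=> // x u.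
  by transitivity (a (f' (x :: u))); rewrite // fE a_cons addrA.
exists (fun x => if (x + i' == 0)%R then (a * s x)%g
                 else if (x + i' == 1)%R then s x else (t * s x)%g).
exists (fun x => (U x + (x == - i')%R%:R)%R); split=> [x u|x|].
- transitivity (t (f' (x :: u))); rewrite // fE t_cons.
  by case: ifP => // _; case: ifP.
- have -> : (x == - i' = (x + i' == 0))%R by rewrite addr_eq0.
  have -> : (x + 1 == - i' = (x + i' == 1 + 1))%R.
    by rewrite -addr_eq0 addrAC; case: (x + i')%R => [[|[|[|]]]].
  have {cs} := cs x; case: (x + i')%R => [[|[|[|]]]] //= lt3 cs.
  + by rewrite addr0; apply: has_class_a.
  + by rewrite !addr0.
  + by rewrite addr0; apply: has_class_t.
- rewrite big_split /= sU; congr (_ + _)%R.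
  by rewrite (bigD1 (- i')%R) //= eqxx big1 ?addr0 // => k /negPf->.
Qed.

(** A nonzero shift of [Z/3] is transitive: this is what makes every section of
    a cube involve all three of the original sections. *)
Lemma sum_orbit (U : 'I_3 -> 'I_3) (x i : 'I_3) : i != 0%R ->
  (U (x + i + i) + U (x + i) + U x = \sum_y U y)%R.
Proof.
move=> i0; rewrite (bigD1 x) //= (bigD1 (x + i)%R) /=; last first.
  by rewrite -subr_eq0 addrC addKr.
rewrite (big_pred1 (x + i + i)%R) => [|y].
  by rewrite [LHS]addrC [(U (x + i + i) + _)%R]addrC.
move: i0; case: x => [[|[|[|]]]] //= ?; case: i => [[|[|[|]]]] //= ? _;
  by case: y => [[|[|[|]]]].
Qed.

Lemma section_expg (f : tree_aut) (s : 'I_3 -> tree_aut) :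
  (forall x u, f (x :: u) = x :: s x u) ->
  forall n x u, (f ^+ n)%g (x :: u) = x :: (s x ^+ n)%g u.
Proof.
move=> fE; elim=> [|n IH] x u; rewrite ?expg0 // !expgS.
by transitivity (f ((f ^+ n)%g (x :: u))); rewrite // IH fE.
Qed.

Lemma section_torsion (f : tree_aut) (s : 'I_3 -> tree_aut) n :
  (forall x u, f (x :: u) = x :: s x u) -> (f ^+ n)%g = 1%g ->
  forall x, (s x ^+ n)%g = 1%g.
Proof.
move=> fE fn x; apply: tree_aut_eq => u.
by have [] : x :: (s x ^+ n)%g u = x :: u by rewrite -(section_expg fE) fn.
Qed.

(** * Torsion *)

(** The subgroup of the words with [i = 0] does contain torsion, for instance
    [t]; and so does that with [j = 0].  When both are nonzero, cubing keeps both
    entries of the classes of the sections nonzero, so the order can be divided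
    by [3] forever. *)
Lemma infinite_order f i j n : has_class f i j -> i != 0%R -> j != 0%R ->
  0 < n -> (f ^+ n)%g <> 1%g.
Proof.
elim/ltn_ind: n f i j => n IH f i j cf i0 j0 n0 fn.
have [s [U [fE cs sU]]] := sections_of_class cf.
have [s' fE'] : exists s' : nat -> 'I_3 -> tree_aut,
    forall k x u, (f ^+ k)%g (x :: u) = (x + i *+ k)%R :: s' k x u.
  exists (fix s' k x :=
    if k is k'.+1 then (s (x + i *+ k')%R * s' k' x)%g else 1%g).
  elim=> [|k IHk] x u; first by rewrite expg0 mulr0n addr0.
  rewrite expgS; transitivity (f ((f ^+ k)%g (x :: u))) => //.
  by rewrite IHk fE mulrSr addrA.
have /dvdnP[m nE] : 3 %| n.
  have /(congr1 (head 0%R)) : (f ^+ n)%g [:: 0%R] = [:: 0%R] by rewrite fn.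
  rewrite fE' [head _ _]add0r => /eqP.
  rewrite {1}(divn_eq n 3) mulrnDr mulnC mulrnA.
  have -> : (i *+ 3 = 0)%R by apply: val_inj; case: (i) => [[|[|[|]]]].
  rewrite mul0rn add0r /dvdn; move: i0 (ltn_pmod n (isT : 0 < 3)).
  by case: (i) => [[|[|[|]]]] //= ?; case: (n %% 3) => [|[|[|]]].
rewrite nE muln_gt0 andbT in n0.
have f3E x u : (f ^+ 3)%g (x :: u) =
    x :: (s (x + i + i)%R * (s (x + i)%R * s x))%g u.
  transitivity (f (f (f (x :: u)))) => //; rewrite !fE; congr (_ :: _).
  by apply: val_inj; case: (x) (i) => [[|[|[|]]]] // ? [[|[|[|]]]].
have c3 x : has_class (s (x + i + i)%R * (s (x + i)%R * s x))%g j j.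
  have := has_classM (cs (x + i + i)%R)
            (has_classM (cs (x + i)%R) (cs x)).
  rewrite !addrA [(x + i + i + 1)%R]addrAC [(x + i + 1)%R]addrAC.
  by rewrite !sum_orbit // sU.
apply: (IH m _ _ j j (c3 0%R)) => //; first by rewrite nE ltn_Pmulr.
by apply: (section_torsion f3E); rewrite -expgnA mulnC -nE.
Qed.

(** Finite order and the class [(0, 0)] are both inherited by all the sections,
    the latter thanks to [infinite_order]; so triviality on the first level, which
    the entry [i = 0] expresses, propagates to every level. *)
Lemma torsion_of_class0 f n : has_class f 0%R 0%R -> 0 < n ->
  (f ^+ n)%g = 1%g -> f = 1%g.
Proof.
move=> cf n0 fn; apply: tree_aut_eq => w; change (f w = w).
elim: w f cf fn => [|x w IH] f cf fn; first by case: (tree_autP f).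
have [s [U [fE cs sU]]] := sections_of_class cf.
have {}fE y u : f (y :: u) = y :: s y u by rewrite fE addr0.
have sn := section_torsion fE fn.
rewrite fE IH //; suff U0 y : U y = 0%R by have := cs x; rewrite !U0.
have nz z : (U z == 0)%R || (U (z + 1) == 0)%R.
  apply/norP=> -[U0 U1]; exact: (infinite_order (cs z) U0 U1 n0 (sn z)).
rewrite -(sum_orbit U y (i := 1%R) isT) in sU.
have := nz (y + 1)%R; have := nz y; have := nz (y + 1 + 1)%R.
have -> : (y + 1 + 1 + 1 = y)%R by apply: val_inj; case: (y) => [[|[|[|]]]].
move: sU; move: (U (y + 1 + 1)%R) (U (y + 1)%R) (U y) => p q r.
case: (altP (q =P 0%R)) => [->|_] /=; case: (altP (r =P 0%R)) => //= _.
  by rewrite addr0 orbF => + /eqP pE; rewrite pE add0r.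
Qed.

(** * The subgroup [K] and its cosets *)

Section GeneratedSubgroups.
Context {G : groupType} (A : set G).

Lemma subgroup_gen_is_subgroup : is_subgroup (subgroup_gen A).
Proof.
split; first by apply/mem_set => H [[/set_mem H1 _] _].
move=> f g /set_mem fH /set_mem gH; apply/mem_set => H HA.
by apply/set_mem/(HA.1.2); apply/mem_set; [apply: fH|apply: gH].
Qed.

Lemma subgroup_gen1 : subgroup_gen A 1%g.
Proof. exact/set_mem/(subgroup_gen_is_subgroup.1). Qed.

Lemma subgroup_genM f g :
  subgroup_gen A f -> subgroup_gen A g -> subgroup_gen A (f * g)%g.
Proof.
move=> /mem_set Af /mem_set Ag; apply/set_mem.
exact: (group_closedM subgroup_gen_is_subgroup Af Ag).
Qed.

Lemma subgroup_genV f : subgroup_gen A f -> subgroup_gen A f^-1%g.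
Proof.
move=> /mem_set Af; apply/set_mem.
exact: (group_closedV subgroup_gen_is_subgroup Af).
Qed.

Lemma subgroup_gen_sub (H : set G) :
    H 1%g -> (forall f g, H f -> H g -> H (f * g)%g) ->
    (forall f, H f -> H f^-1%g) -> (A `<=` H)%classic ->
  (subgroup_gen A `<=` H)%classic.
Proof.
move=> H1 HM HV; apply: smallest_sub; split; first exact/mem_set.
by move=> f g /set_mem Hf /set_mem Hg; apply/mem_set/HM => //; apply: HV.
Qed.

End GeneratedSubgroups.

Lemma K_at : K (a * t)%g.
Proof. by apply: sub_gen_smallest; left. Qed.

Lemma K_ta : K (t * a)%g.
Proof. by apply: sub_gen_smallest; right. Qed.

Lemma K_sub_Gamma : (K `<=` Gamma)%classic.
Proof.
have Ga : Gamma a by apply: sub_gen_smallest; left.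
have Gt : Gamma t by apply: sub_gen_smallest; right.
apply: subgroup_gen_sub; [exact: subgroup_gen1|exact: subgroup_genM| |].
  exact: subgroup_genV.
by move=> f [] ->; apply: subgroup_genM.
Qed.

Lemma K_class f : K f -> exists i, has_class f i i.
Proof.
move: f; apply: subgroup_gen_sub.
- by exists 0%R; apply: has_class1.
- by move=> f g [i cf] [j cg]; exists (i + j)%R; apply: has_classM.
- by move=> f [i cf]; exists (- i)%R; apply: has_classV.
- move=> f [] ->; exists 1%R.
    by have := has_classM class_a class_t; rewrite addr0 add0r.
  by have := has_classM class_t class_a; rewrite addr0 add0r.
Qed.

Lemma Gamma_class f : Gamma f -> exists i j, has_class f i j.
Proof.
move: f; apply: subgroup_gen_sub.
- by exists 0%R, 0%R; apply: has_class1.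
- move=> f g [i [j cf]] [k [l cg]].
  by exists (i + k)%R, (j + l)%R; apply: has_classM.
- by move=> f [i [j cf]]; exists (- i)%R, (- j)%R; apply: has_classV.
- by move=> f [] ->; do 2!eexists; [apply: class_a|apply: class_t].
Qed.

(** The representative [k] is tracked along the word: a letter [a] raises it by
    one, and a letter [t] lowers it by one modulo [K]. *)
Lemma coset_repr f i j : has_class f i j ->
  exists k : 'I_3, exists2 h, K h & f = (a ^+ k * h)%g.
Proof.
elim=> [|f' i' j' _ [k [h Kh ->]]|f' i' j' _ [k [h Kh ->]]].
- by exists ord0, 1%g; [exact: subgroup_gen1|rewrite expg0 mulg1].
- exists (ordS k), h => //; rewrite mulgA -expgS.
  by case: k => [[|[|[|]]]] //= _; rewrite expgS expg2 a3 expg0.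
- case: k => [[|[|[|]]]] //= _.
  + exists (inord 2), (a * t * h)%g.
      exact: subgroup_genM K_at Kh.
    by rewrite inordK // expg2 -aV expg0 mul1g -mulgA mulKg.
  + exists ord0, (t * a * h)%g; first exact: subgroup_genM K_ta Kh.
    by rewrite expg0 expg1 mul1g mulgA.
  + exists (inord 1), ((t * a)^-1 * (a * t)^-1 * h)%g.
      by do 2!apply: subgroup_genM => //; apply: subgroup_genV;
        [exact: K_ta|exact: K_at].
    (* (ta)^-1 (at)^-1 = a^-1 t^-2 a^-1 = a^-1 t a^-1 *)
    rewrite inordK // expg1 expg2 !invgM !mulgA mulgV mul1g.
    by rewrite -[(t^-1 * t^-1)%g]invgM -tV invgK aV !mulgA.
Qed.

Lemma K_torsion_free : torsion_free K.
Proof.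
move=> f Kf n n0 fn; have [i cf] := K_class Kf.
have [i0|i0] := eqVneq i 0%R; last by case: (infinite_order cf i0 i0 n0).
by rewrite i0 in cf; apply: torsion_of_class0 cf n0 fn.
Qed.

Lemma finite_cosets_K : finite_set (lcosets_of Gamma K).
Proof.
apply: (@sub_finite_set _ _
  [set [set (a ^+ k * h)%g | h in K] | k in [set: 'I_3]]%classic).
  move=> _ [f Gf <-]; have [i [j cf]] := Gamma_class Gf.
  have [k [h Kh ->]] := coset_repr cf; exists k => //.
  apply/seteqP; split=> _ [h' Kh' <-].
    exists (h^-1 * h')%g; last by rewrite -mulgA mulVKg.
    exact: subgroup_genM (subgroup_genV Kh) Kh'.
  by exists (h * h')%g; [exact: subgroup_genM|rewrite mulgA].
exact: finite_image finite_finset.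
Qed.

Theorem theorem6p4 : torsion_free K /\ virtually_torsion_free Gamma.
Proof.
split; first exact: K_torsion_free.
exists K; split; [exact: subgroup_gen_is_subgroup|exact: K_sub_Gamma| |].
  exact: finite_cosets_K.
exact: K_torsion_free.
Qed.
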